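(* Let $n\ge 1$ and let $G=W_n$ be the centipede graph. Let $K$ be a field, let $T=K[s_v,t_v: v\in V(W_n)]$, and let $I\subset T$ be the monomial ideal of independent sets of $W_n$. Then $$\beta_i(I)=\sum_{k=0}^{n}\sum_{j=0}^{k}\binom{n-j}{n-k}\binom{n+1-j}{j}\binom{k}{i}\quad\text{for } i\ge 0,\qquad\text{and}\qquad \mathrm{proj\,dim}(T/I)=n+1.$$
   Context: The centipede graph $W_n$ has vertex set $V(W_n)=\{a_1,\dots,a_n\}\cup\{b_1,\dots,b_n\}$ ($2n$ vertices) and edge set $E(W_n)=\{\{a_i,b_i\}:1\le i\le n\}\cup\{\{b_j,b_{j+1}\}:1\le j\le n-1\}$. A set of vertices of a graph is independent if no two of its elements are adjacent (the empty set is independent). The monomial ideal of independent sets of a graph $G$ with vertex set $V(G)$ is the squarefree monomial ideal of $K[s_v,t_v:v\in V(G)]$ generated by the monomials $\prod_{v\in S}s_v\prod_{v\in V(G)\setminus S}t_v$, with $S$ ranging over all independent sets of $G$. $\beta_i(I)$ denotes the $i$-th total Betti number, i.e. the rank of the $i$-th free module in the minimal graded free resolution of $I$ over $T$ (with $\beta_0(I)$ the number of minimal generators of $I$). Convention: $\binom{a}{b}=0$ for integers $b>a\ge 0$. *)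

(* Defs.v *)
From HB Require Import structures.
From mathcomp Require Import all_boot all_order all_algebra.
From mathcomp Require Import ring_quotient.
From mathcomp.multinomials Require Import mpoly.
From mathcomp Require boolp.

Set Implicit Arguments.
Unset Strict Implicit.
Unset Printing Implicit Defensive.

Import GRing.Theory.

Local Open Scope ring_scope.
Local Open Scope quotient_scope.

Section IdealAndQuotient.
Variables (R : comNzRingType) (g : seq R).

Definition ideal_gen : {pred R} := fun p =>
  boolp.asbool (exists c : 'I_(size g) -> R, p = \sum_i c i * g`_i).

Lemma ideal_genP p :
  reflect (exists c : 'I_(size g) -> R, p = \sum_i c i * g`_i)
          (p \in ideal_gen).
Proof. exact: boolp.asboolP. Qed.

Lemma ideal_gen_zmod_closed : zmod_closed ideal_gen.
Proof.
split=> [|x y /ideal_genP[c ->] /ideal_genP[d ->]]; apply/ideal_genP.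
  by exists (fun=> 0); rewrite big1 // => i _; rewrite mul0r.
exists (fun i => c i - d i); rewrite -sumrB.
by apply: eq_bigr => i _; rewrite mulrBl.
Qed.

HB.instance Definition _ :=
  GRing.isZmodClosed.Build R ideal_gen ideal_gen_zmod_closed.

Lemma ideal_genMl a x : x \in ideal_gen -> a * x \in ideal_gen.
Proof.
move=> /ideal_genP[c ->]; apply/ideal_genP; exists (fun i => a * c i).
by rewrite mulr_sumr; apply: eq_bigr => i _; rewrite mulrA.
Qed.

(* The R-module R/(g). The additive group is the library quotient; the
   library's ring quotient is not used as it requires a proper ideal. *)
Definition quot_mod := Quotient.quot ideal_gen.
HB.instance Definition _ := GRing.Zmodule.on quot_mod.

Definition quot_scale (a : R) (x : quot_mod) : quot_mod :=
  \pi_(Quotient.quot ideal_gen) (a * repr x).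

Lemma quot_scale_pi (a p : R) :
  quot_scale a (\pi_(Quotient.quot ideal_gen) p)
    = \pi_(Quotient.quot ideal_gen) (a * p).
Proof.
apply/eqP; rewrite /quot_scale -Quotient.idealrBE -mulrBr.
by apply: ideal_genMl; rewrite Quotient.idealrBE reprK.
Qed.

Let quot_piD (p q : R) :
  \pi_(Quotient.quot ideal_gen) (p + q)
    = (\pi_(Quotient.quot ideal_gen) p + \pi_(Quotient.quot ideal_gen) q
         : Quotient.quot ideal_gen).
Proof. exact: Quotient.pi_add. Qed.

Lemma quot_scaleA a b x : quot_scale a (quot_scale b x) = quot_scale (a * b) x.
Proof. by rewrite quot_scale_pi mulrA. Qed.

Lemma quot_scale1 : left_id 1 quot_scale.
Proof. by move=> x; rewrite /quot_scale mul1r reprK. Qed.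

Lemma quot_scaleDr : right_distributive quot_scale +%R.
Proof.
move=> a x y; rewrite -[x]reprK -[y]reprK -[_ + _]quot_piD.
by rewrite !quot_scale_pi mulrDr quot_piD.
Qed.

Lemma quot_scaleDl x : {morph quot_scale^~ x : a b / a + b}.
Proof. by move=> a b; rewrite /quot_scale mulrDl quot_piD. Qed.

HB.instance Definition _ := GRing.Zmodule_isLmodule.Build R quot_mod
  quot_scaleA quot_scale1 quot_scaleDr quot_scaleDl.

End IdealAndQuotient.

Section ProjectiveDimension.
Variable R : nzRingType.

Definition projective_module (P : lmodType R) : Prop :=
  forall (A B : lmodType R) (p : {linear A -> B}) (f : {linear P -> B}),
    (forall b, exists a, p a = b) ->
    exists h : {linear P -> A}, forall x, p (h x) = f x.

Record augmented_sequence (M : lmodType R) := AugmentedSequence {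
  seq_mod : nat -> lmodType R;
  seq_diff : forall i, {linear seq_mod i.+1 -> seq_mod i};
  seq_aug : {linear seq_mod 0 -> M}
}.

Record is_projective_resolution (M : lmodType R) (P : augmented_sequence M) :
    Prop := IsProjectiveResolution {
  projres_projective : forall i, projective_module (seq_mod P i);
  projres_aug_surj : forall y, exists x, seq_aug P x = y;
  projres_exact0 : forall x, seq_aug P x = 0 <-> exists z, seq_diff P 0 z = x;
  projres_exact : forall i x,
    seq_diff P i x = 0 <-> exists z, seq_diff P i.+1 z = x
}.

Definition has_projective_resolution_of_length (M : lmodType R) (d : nat) :
    Prop :=
  exists P : augmented_sequence M,
    is_projective_resolution P /\
    forall i, (d < i)%N -> forall x : seq_mod P i, x = 0.

Definition proj_dim_eq (M : lmodType R) (d : nat) : Prop :=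
  has_projective_resolution_of_length M d /\
  forall d', has_projective_resolution_of_length M d' -> (d <= d')%N.

End ProjectiveDimension.

Section BettiNumbers.
Variables (K : fieldType) (N : nat).
Local Notation T := {mpoly K[N]}.

(* Only 0 is homogeneous of negative degree. *)
Definition homog_of_degree (d : int) (p : T) : Prop :=
  match d with
  | Posz e => p \is e.-homog
  | Negz _ => p = 0
  end.

(* F_i is the direct sum over j of the T(- shift i j), as row vectors, and maps
   act by v |-> v *m A: row j of fres_diff i is the image of the j-th basis
   element of F_(i+1), and fres_aug is the map F_0 -> T onto the ideal. *)
Record free_sequence := FreeSequence {
  fres_rank : nat -> nat;
  fres_shift : forall i, 'I_(fres_rank i) -> int;
  fres_diff : forall i, 'M[T]_(fres_rank i.+1, fres_rank i);
  fres_aug : 'cV[T]_(fres_rank 0)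
}.

Definition irrelevant_ideal : {pred T} :=
  ideal_gen [seq 'X_i | i <- enum 'I_N].

Record is_minimal_graded_free_resolution (g : seq T) (F : free_sequence) :
    Prop := IsMinimalGradedFreeResolution {
  mfres_aug_homog : forall j,
    homog_of_degree (fres_shift j) (fres_aug F j 0);
  mfres_diff_homog : forall i j k,
    homog_of_degree (fres_shift j - fres_shift k) (fres_diff F i j k);
  mfres_aug_image : forall p : T,
    p \in ideal_gen g <->
    exists v : 'rV_(fres_rank F 0), (v *m fres_aug F) 0 0 = p;
  mfres_exact0 : forall v : 'rV_(fres_rank F 0),
    v *m fres_aug F = 0 <-> exists w, w *m fres_diff F 0 = v;
  mfres_exact : forall i (v : 'rV_(fres_rank F i.+1)),
    v *m fres_diff F i = 0 <-> exists w, w *m fres_diff F i.+1 = v;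
  mfres_minimal : forall i j k, fres_diff F i j k \in irrelevant_ideal
}.

(* beta_i((g)) = b. Existence is part of the assertion and b is required to be
   the rank in every minimal resolution, so no choice of one is made. *)
Definition betti_eq (g : seq T) (i b : nat) : Prop :=
  (exists F, is_minimal_graded_free_resolution g F) /\
  forall F, is_minimal_graded_free_resolution g F -> fres_rank F i = b.

End BettiNumbers.

Section IndependentSets.
Variables (V : finType) (e : rel V).

Definition independent (S : {set V}) : bool :=
  [forall x in S, forall y in S, ~~ e x y].

Variable K : fieldType.

(* Variables are indexed by V + V: inl v stands for s_v and inr v for t_v. *)
Local Notation indep_ring := {mpoly K[#|{: V + V}|]}.
Definition svar (v : V) : indep_ring := 'X_(enum_rank (inl v : V + V)).
Definition tvar (v : V) : indep_ring := 'X_(enum_rank (inr v : V + V)).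

Definition indep_mon (S : {set V}) : indep_ring :=
  (\prod_(v in S) svar v) * \prod_(v in ~: S) tvar v.

Definition indep_gens : seq indep_ring :=
  [seq indep_mon A | A : {set V} <- enum [pred A : {set V} | independent A]].

End IndependentSets.

(* inl i is a_(i+1) and inr i is b_(i+1). *)
Definition centipede (n : nat) : rel ('I_n + 'I_n) := fun x y =>
  match x, y with
  | inl i, inr j | inr i, inl j => i == j
  | inr i, inr j => (i.+1 == j :> nat) || (j.+1 == i :> nat)
  | inl _, inl _ => false
  end.
Arguments centipede n : clear implicits.

(* Main.v *)
From HB Require Import structures.
Require Import Defs.
From mathcomp Require Import all_boot all_order all_algebra.
From mathcomp Require Import ring_quotient.
From mathcomp.multinomials Require Import mpoly.
From mathcomp Require boolp.

(** Independent sets form a simplicial complex, and the argument works for the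
ideal I of monomials u_S = prod_(v in S) s_v * prod_(v notin S) t_v, with S
ranging over the faces of any simplicial complex D on a nonempty vertex set V
(so that no u_S is constant).

The resolution is cubical.  Its basis in degree i consists of the cells (S, A)
with A \subset S in D and #|A| = i; such a cell is the cube of all sets between
S \ A and S, its multidegree is lcm (u_S, u_(S \ A)) = u_S * prod_(v in A) t_v,
and its boundary is
  sum_(v in A) +- (t_v (S, A \ v) - s_v (S \ v, A \ v)).
All entries are variables up to sign, so the complex is linear and minimal; it
is a Koszul complex for the commuting operators [edge v], so consecutive
boundaries cancel ([bdry_bdry]).  For exactness ([bdry_exact]) filter by #|S|:
on the top layer only the terms t_v (S, A \ v) survive, and they form the Koszul
complex of the variables t_v, v in S, whose acyclicity ([koszul_exact]) comes
from a cone homotopy on monomials.  Subtracting the boundary of the homotopy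
kills the top layer of a cycle, and induction finishes.  In degree 0 one needs
moreover that in a relation sum_S c_S u_S = 0 every monomial of a top
coefficient c_S is divisible by some t_v, v in S ([aug_top]).  Hence the i-th
Betti number is the sum over the faces S of binomial (#|S|, i), and the last
nonzero free module sits in degree max #|S|.

That these ranks do not depend on the resolution, and that no projective
resolution of T/I is shorter, both follow from one fact
([resolution_retract]): for two projective resolutions P, Q of the same module,
the composite P -> Q -> P of comparison maps is the identity up to a homotopy.
If P is minimal, the homotopy vanishes after evaluating all variables at 0, so
over the residue field P_i becomes a retract of Q_i ([minimal_rank_le]).  Taking
Q minimal compares two Betti numbers, taking Q with Q_i = 0 bounds the
projective dimension.

For the centipede, an independent set is a set B of pairwise nonconsecutive
indices of spine vertices together with a set of leaves avoiding B.  There are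
binomial (n+1-j, j) choices for B of size j, and then binomial (n-j, k-j)
choices giving a set of size k ([sum_independent_centipede]); the set of all
leaves is independent and has the maximal size n. *)

Set Implicit Arguments.
Unset Strict Implicit.
Unset Printing Implicit Defensive.

Import GRing.Theory.
Local Open Scope ring_scope.

(** * Comparison of projective resolutions *)

Section ImageModule.
Variables (R : nzRingType) (A B : lmodType R) (q : {linear A -> B}).

Definition image_pred : {pred B} := fun b => boolp.asbool (exists a, q a = b).

Lemma image_predP b : reflect (exists a, q a = b) (b \in image_pred).
Proof. exact: boolp.asboolP. Qed.

Lemma image_pred_submod : submod_closed image_pred.
Proof.
split=> [|k _ _ /image_predP[a <-] /image_predP[b <-]]; apply/image_predP.
  by exists 0; rewrite linear0.
by exists (k *: a + b); rewrite linearP.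
Qed.
HB.instance Definition _ :=
  GRing.isSubmodClosed.Build R B image_pred image_pred_submod.

(** The image of a linear map has to be a module in its own right, because
projectivity lifts only along surjections onto a whole module. *)
Record image_module :=
  ImageModule { image_val : B; image_valP : image_val \in image_pred }.
HB.instance Definition _ := [isSub for image_val].
HB.instance Definition _ := [Choice of image_module by <:].
HB.instance Definition _ := [SubChoice_isSubLmodule of image_module by <:].

Variables (P : lmodType R) (f : {linear P -> B}).
Hypothesis fq : forall x, exists a, q a = f x.

Definition corestrict (x : P) : image_module :=
  ImageModule (introT (image_predP (f x)) (fq x)).

Lemma corestrict_linear : linear corestrict.
Proof. by move=> k x y; apply: val_inj; rewrite /= linearP. Qed.
HB.instance Definition _ :=
  GRing.isLinear.Build R P image_module *:%R corestrict corestrict_linear.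

End ImageModule.

Section Homology.
Variable R : nzRingType.

(** Projectivity for maps [q] that are not onto: corestrict to the image of [q]. *)
Lemma projective_lift (P A B : lmodType R) (q : {linear A -> B})
    (f : {linear P -> B}) :
  projective_module P -> (forall x, exists a, q a = f x) ->
  exists h : {linear P -> A}, forall x, q (h x) = f x.
Proof.
move=> projP fq; have qq a : exists a', q a' = q a by exists a.
have [|h hE] := projP A (image_module q) (corestrict qq) (corestrict fq).
  by case=> b bP; have [a qa] := image_predP q b bP; exists a; apply: val_inj.
by exists h => x; have /(congr1 val) := hE x.
Qed.

Lemma free_projective m : projective_module 'rV[R]_m.
Proof.
move=> A B p f /(_ _)/boolp.cid sec.
pose a j := projT1 (sec (f (delta_mx 0 j))).
have aE j : p (a j) = f (delta_mx 0 j) by rewrite /a; case: (sec _).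
pose h (v : 'rV[R]_m) := \sum_j v 0 j *: a j.
have hL : linear h.
  move=> k x y; rewrite /h scaler_sumr -big_split /=.
  by apply: eq_bigr => j _; rewrite !mxE scalerDl scalerA.
pose hl := GRing.isLinear.Build R 'rV[R]_m A *:%R h hL.
exists (HB.pack_for {linear 'rV[R]_m -> A} h hl) => x /=.
rewrite {2}[x]row_sum_delta !linear_sum; apply: eq_bigr => j _.
by rewrite !linearZ /= aE.
Qed.

Variable M : lmodType R.

Section Comparison.
Variables (P Q : augmented_sequence M).
Hypothesis (resP : is_projective_resolution P)
           (resQ : is_projective_resolution Q).

(** The invariant of the recursive construction of a chain map: exactness of Q
turns it into the existence of the next component, which satisfies it again. *)
Definition liftable i (f : {linear seq_mod P i -> seq_mod Q i}) : Prop :=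
  forall x, exists y, seq_diff Q i y = f (seq_diff P i x).

Lemma comparison0 : exists f : {linear seq_mod P 0 -> seq_mod Q 0},
  (forall x, seq_aug Q (f x) = seq_aug P x) /\ liftable f.
Proof.
have [x|f fE] := projective_lift (q := seq_aug Q) (f := seq_aug P)
  (@projres_projective _ _ _ resP 0%N).
  exact: projres_aug_surj.
exists f; split=> // x; apply/(projres_exact0 resQ).
by rewrite fE; apply/(projres_exact0 resP); exists x.
Qed.

Lemma comparisonS i (f : {linear seq_mod P i -> seq_mod Q i}) : liftable f ->
  exists f' : {linear seq_mod P i.+1 -> seq_mod Q i.+1},
  (forall x, seq_diff Q i (f' x) = f (seq_diff P i x)) /\ liftable f'.
Proof.
move=> lf; have [|f' f'E] := projective_lift (q := seq_diff Q i)
  (f := f \o seq_diff P i) (@projres_projective _ _ _ resP i.+1).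
  exact: lf.
exists f'; split=> // x; apply/(projres_exact resQ).
have dd : seq_diff P i (seq_diff P i.+1 x) = 0.
  by apply/(projres_exact resP); exists x.
by rewrite f'E /= dd linear0.
Qed.

Lemma comparison : exists f : forall i, {linear seq_mod P i -> seq_mod Q i},
  (forall x, seq_aug Q (f 0%N x) = seq_aug P x) /\
  (forall i x, seq_diff Q i (f i.+1 x) = f i (seq_diff P i x)).
Proof.
have [f0 [f0E lf0]] := boolp.cid comparison0.
pose step i (f : {f : {linear seq_mod P i -> seq_mod Q i} | liftable f}) :=
  boolp.cid (comparisonS (proj2_sig f)).
pose fix F i : {f : {linear seq_mod P i -> seq_mod Q i} | liftable f} :=
  match i with
  | 0%N => exist _ f0 lf0
  | j.+1 => exist _ (projT1 (step j (F j))) (projT2 (step j (F j))).2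
  end.
exists (fun i => proj1_sig (F i)); split=> // i x.
exact: (projT2 (step i (F i))).1.
Qed.

End Comparison.

(** A chain endomorphism over the zero map of M is null-homotopic.  Each component
of the homotopy is needed by itself only, so the components are not assembled
into one family. *)
Lemma null_homotopy (P : augmented_sequence M)
    (phi : forall i, {linear seq_mod P i -> seq_mod P i}) :
    is_projective_resolution P ->
    (forall x, seq_aug P (phi 0%N x) = 0) ->
    (forall i x, seq_diff P i (phi i.+1 x) = phi i (seq_diff P i x)) ->
  forall i, exists h : {linear seq_mod P i -> seq_mod P i.+1},
    forall x, exists y, phi i.+1 x = h (seq_diff P i x) + seq_diff P i.+1 y.
Proof.
move=> resP phi0 phiS.
have dd i x : seq_diff P i (seq_diff P i.+1 x) = 0.
  by apply/(projres_exact resP); exists x.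
(* The same partial condition on [h] serves at every stage: it makes
   phi - h d a cycle one degree higher. *)
have next i (h : {linear seq_mod P i -> seq_mod P i.+1}) :
    (forall x, seq_diff P i (h (seq_diff P i x)) = phi i (seq_diff P i x)) ->
    forall x, exists y, phi i.+1 x = h (seq_diff P i x) + seq_diff P i.+1 y.
  move=> hE x; have [|y yE] := (projres_exact resP
      (phi i.+1 x - h (seq_diff P i x))).1.
    by rewrite linearB /= phiS hE subrr.
  by exists y; rewrite yE addrC subrK.
elim=> [|i [h hE]].
  have [x|h hE] := projective_lift (q := seq_diff P 0) (f := phi 0%N)
    (@projres_projective _ _ _ resP 0%N).
    exact/(projres_exact0 resP).
  by exists h; apply: next => x; rewrite hE.
have [x|h' h'E] := projective_lift (q := seq_diff P i.+1)
    (f := phi i.+1 \- (h \o seq_diff P i)) (@projres_projective _ _ _ resP i.+1).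
  by have [y yE] := hE x; exists y; rewrite /= yE addrC addKr.
by exists h'; apply: next => x; rewrite h'E /= dd linear0 subr0.
Qed.

(** The composite [g \o f] lifts the identity of M, so [g \o f - id] lifts 0. *)
Lemma resolution_retract (P Q : augmented_sequence M) :
    is_projective_resolution P -> is_projective_resolution Q ->
  forall i, exists (f : {linear seq_mod P i.+1 -> seq_mod Q i.+1})
    (g : {linear seq_mod Q i.+1 -> seq_mod P i.+1})
    (h : {linear seq_mod P i -> seq_mod P i.+1}),
  forall x, exists y,
    g (f x) = x + h (seq_diff P i x) + seq_diff P i.+1 y.
Proof.
move=> resP resQ i.
have [f [f0 fS]] := comparison resP resQ.
have [g [g0 gS]] := comparison resQ resP.
have [||h hE] := @null_homotopy P
  (fun i => (g i \o f i) \- idfun : {linear _ -> _}) resP _ _ i.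
- by move=> x /=; rewrite linearB /= g0 f0 subrr.
- by move=> j x /=; rewrite linearB /= gS fS.
exists (f i.+1), (g i.+1), h => x; have [y /= yE] := hE x.
by exists y; rewrite -addrA -yE addrC subrK.
Qed.

End Homology.

(** * Minimal free resolutions *)

Section MinimalResolutions.
Variables (K : fieldType) (N : nat).
Local Notation T := {mpoly K[N]}.
Local Open Scope quotient_scope.

Lemma mem_ideal_gen (R : comNzRingType) (g : seq R) x :
  x \in g -> x \in ideal_gen g.
Proof.
move=> gx; apply/ideal_genP; have ix : (index x g < size g)%N by rewrite index_mem.
exists (fun i => (i == Ordinal ix)%:R).
rewrite (bigD1 (Ordinal ix)) //= eqxx mul1r nth_index // big1 ?addr0 //.
by move=> i /negPf ->; rewrite mul0r.
Qed.

Lemma ideal_gen_sub (R : comNzRingType) (g h : seq R) :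
  {subset g <= ideal_gen h} -> {subset ideal_gen g <= ideal_gen h}.
Proof.
move=> gh _ /ideal_genP[c ->]; apply: rpred_sum => i _.
by apply: ideal_genMl; apply: gh; rewrite mem_nth.
Qed.

Lemma irrelevant_mcoeff0 (p : T) : p \in @irrelevant_ideal K N -> p@_0%MM = 0.
Proof.
move=> /ideal_genP[c ->]; rewrite raddf_sum big1 // => i _ /=.
rewrite rmorphM /=; set x := nth _ _ _.
suff [j ->] : exists j, x = 'X_j.
  by rewrite mcoeffX -mdeg_eq0 mdeg1 mulr0.
have /mapP[j _ ->] : x \in [seq 'X_i | i <- enum 'I_N] by rewrite mem_nth.
by exists j.
Qed.

Section Extension.
Variables (g : seq T) (F : free_sequence K N).

Definition quot_proj (v : 'rV[T]_1) : quot_mod g :=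
  \pi_(Quotient.quot (ideal_gen g)) (v 0 0).

Lemma quot_proj_linear : linear quot_proj.
Proof.
move=> k u v; rewrite /quot_proj !mxE.
by rewrite [LHS]Quotient.pi_add /=; congr (_ + _); exact/esym/quot_scale_pi.
Qed.
HB.instance Definition _ :=
  GRing.isLinear.Build T 'rV[T]_1 (quot_mod g) *:%R quot_proj quot_proj_linear.

Lemma quot_proj_eq0 v : quot_proj v = 0 <-> v 0 0 \in ideal_gen g.
Proof.
have pi0 : \pi_(Quotient.quot (ideal_gen g)) 0 = 0 :> quot_mod g.
  exact: (raddf0 (\pi_(Quotient.quot (ideal_gen g)))).
rewrite -[X in X \in _]subr0 Quotient.idealrBE -pi0.
by split=> [v0|/eqP//]; apply/eqP; exact: v0.
Qed.

(** A resolution of the ideal, continued by T -> T/I, is a resolution of T/I in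
which the augmentation becomes the first differential. *)
Definition ext_rank i := if i is j.+1 then fres_rank F j else 1.

Definition ext_diff i : 'M[T]_(ext_rank i.+1, ext_rank i) :=
  if i is j.+1 then fres_diff F j else fres_aug F.

Definition ext_seq : augmented_sequence (quot_mod g) :=
  @AugmentedSequence T (quot_mod g) (fun i => 'rV[T]_(ext_rank i))
    (fun i => mulmxr (ext_diff i)) quot_proj.

Hypothesis resF : is_minimal_graded_free_resolution g F.

Lemma ext_seq_resolution : is_projective_resolution ext_seq.
Proof.
split=> [i|y|x|[|i] x].
- exact: free_projective.
- by exists (const_mx (repr y)); rewrite /= /quot_proj mxE reprK.
- apply: iff_trans (quot_proj_eq0 x) _.
  apply: iff_trans (mfres_aug_image resF _) _.
  split=> -[v vE]; exists v; last by rewrite -vE.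
  by apply/matrixP=> i j; rewrite !ord1; exact: vE.
- exact: (mfres_exact0 resF).
- exact: (mfres_exact resF).
Qed.

Hypothesis gm : {subset g <= @irrelevant_ideal K N}.

Local Notation red := (map_mx (mcoeff 0%MM)).

Lemma ext_diff_mod i : red (ext_diff i) = 0.
Proof.
apply/matrixP=> j k; rewrite !mxE; apply: irrelevant_mcoeff0.
case: i j k => [|i] j k; last exact: (mfres_minimal resF).
apply: (ideal_gen_sub gm); apply/(mfres_aug_image resF).
by exists (delta_mx 0 j); rewrite -rowE mxE (ord1 k).
Qed.

(** Reduce [b (a x) = x + h (d x) + d y] modulo the variables: both differentials
vanish, so two matrices over K compose to the identity of size [fres_rank F i],
and they factor through K^m. *)
Lemma minimal_rank_le (Q : augmented_sequence (quot_mod g)) i m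
    (f : {linear 'rV[T]_m -> seq_mod Q i.+1})
    (f' : {linear seq_mod Q i.+1 -> 'rV[T]_m}) :
  is_projective_resolution Q -> cancel f' f -> (fres_rank F i <= m)%N.
Proof.
move=> resQ f'K.
have [a [b [h abE]]] := resolution_retract ext_seq_resolution resQ i.
pose A := lin1_mx (f' \o a : {linear 'rV[T]_(fres_rank F i) -> 'rV[T]_m}).
pose B := lin1_mx (b \o f : {linear 'rV[T]_m -> 'rV[T]_(fres_rank F i)}).
apply: (@mulmx1_min _ _ _ (red A) (red B)).
rewrite -map_mxM; apply/row_matrixP=> j.
rewrite -map_row row_mul rowE mul_rV_lin1 mul_rV_lin1 /= f'K.
have [y ->] := abE (delta_mx 0 j); rewrite /= !map_mxD.
have -> u : h u = u *m lin1_mx h by rewrite mul_rV_lin1.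
rewrite !map_mxM !ext_diff_mod !mulmx0 mul0mx !addr0.
by rewrite map_delta_mx rowE mulmx1.
Qed.

End Extension.

Lemma minimal_rank_unique (g : seq T) (F F' : free_sequence K N) i :
    {subset g <= @irrelevant_ideal K N} ->
    is_minimal_graded_free_resolution g F ->
    is_minimal_graded_free_resolution g F' ->
  fres_rank F i = fres_rank F' i.
Proof.
move=> gm resF resF'; apply/eqP; rewrite eqn_leq; apply/andP; split.
  exact: (minimal_rank_le resF gm (Q := ext_seq g F') (f := idfun) (f' := idfun)
    (ext_seq_resolution resF')).
exact: (minimal_rank_le resF' gm (Q := ext_seq g F) (f := idfun) (f' := idfun)
    (ext_seq_resolution resF)).
Qed.

(** A shorter resolution has the zero module in degree [d.+1], which is a retract
of K^0; the rank bound then contradicts [fres_rank F d != 0]. *)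
Lemma proj_dim_minimal (g : seq T) (F : free_sequence K N) d :
    {subset g <= @irrelevant_ideal K N} ->
    is_minimal_graded_free_resolution g F ->
    fres_rank F d != 0 -> (forall i, d < i -> fres_rank F i = 0)%N ->
  proj_dim_eq (quot_mod g) d.+1.
Proof.
move=> gm resF Fd Fgt; split.
  exists (ext_seq g F); split; first exact: ext_seq_resolution.
  move=> [|i] //= di x; move: x; rewrite Fgt // => x; exact: thinmx0.
move=> d' [Q [resQ Q0]]; rewrite ltnNge; apply/negP => le_d'd.
have Q0' x : x = 0 :> seq_mod Q d.+1 by apply: Q0.
have K0 : cancel (\0 : {linear seq_mod Q d.+1 -> 'rV[T]_0})
  (\0 : {linear 'rV[T]_0 -> seq_mod Q d.+1}) by move=> x; rewrite /= [RHS]Q0'.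
by have := minimal_rank_le resF gm resQ K0; rewrite leqn0 (negPf Fd).
Qed.

End MinimalResolutions.

(** * Koszul signs *)

Section Signs.
Variable V : finType.
Implicit Types (v w : V) (A : {set V}).

(** A total order on the vertices, for the signs and for the homotopy. *)
Definition rk v : nat := enum_rank v.

Definition before v A : nat := #|[set u in A | (rk u < rk v)%N]|.

Lemma rk_eq v w : (rk v == rk w) = (v == w).
Proof. by rewrite /rk (inj_eq val_inj) (inj_eq enum_rank_inj). Qed.

Lemma beforeU1 v w A : v \notin A ->
  before w (v |: A) = ((rk v < rk w) + before w A)%N.
Proof.
move=> vA; rewrite /before; case: ltnP => vw.
  have -> : [set u in v |: A | (rk u < rk w)%N]
      = v |: [set u in A | (rk u < rk w)%N].
    by apply/setP=> u; rewrite !inE; case: eqP => //= ->; rewrite vw.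
  by rewrite cardsU1 inE (negPf vA).
apply: eq_card => u; rewrite !inE; case: eqP => //= ->.
by rewrite ltnNge vw andbF.
Qed.

Lemma before_eq0 v A : {in A, forall u, rk v <= rk u}%N -> before v A = 0%N.
Proof.
move=> vA; apply: eq_card0 => u; rewrite !inE ltnNge.
by apply: contraTF isT => /andP[/vA ->].
Qed.

(** Removing two vertices in either order gives opposite signs: exactly one of
them counts the other. *)
Lemma sign_swap (R : pzRingType) v w A : v != w -> v \notin A -> w \notin A ->
  (-1) ^+ before v A * (-1) ^+ before w (v |: A)
    = - ((-1) ^+ before w A * (-1) ^+ before v (w |: A)) :> R.
Proof.
move=> vw vA wA; rewrite !beforeU1 //.
rewrite -!exprD; case: ltngtP => [||/eqP]; last by rewrite rk_eq (negPf vw).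
  by rewrite addnCA exprS mulN1r addnC.
by rewrite [in RHS]addnCA exprS mulN1r opprK addnC.
Qed.

(** Pairing (v, w) with (w, v), rather than doubling the sum, keeps the argument
valid in characteristic 2. *)
Lemma sum_swap_eq0 (U : zmodType) (P : pred V) (G : V -> V -> U) :
  (forall v w, v != w -> P v -> P w -> G v w = - G w v) ->
  \sum_(v | P v) \sum_(w | P w && (w != v)) G v w = 0.
Proof.
move=> Gsw; pose Q (p : V * V) := [&& P p.1, P p.2 & p.2 != p.1].
rewrite (pair_big_dep _ _ G) /= (bigID (fun p => rk p.1 < rk p.2)%N) /=.
rewrite [X in _ + X](reindex_inj (h := fun p => (p.2, p.1))) /=; last first.
  by move=> [a b] [c d] [-> ->].
rewrite -[X in _ + X]opprK -sumrN.
apply/eqP; rewrite subr_eq0; apply/eqP; apply: eq_big => [[v w]|[v w]] /=.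
  rewrite -leqNgt [in RHS]leq_eqVlt rk_eq [w == v]eq_sym.
  by case: (v == w); case: (P v); case: (P w).
by case/andP=> /and3P[Pv Pw wv] _; apply: Gsw; rewrite 1?eq_sym.
Qed.

End Signs.

(** * Acyclicity of the Koszul complex on distinct variables *)

Section KoszulExactness.
Variables (V : finType) (K : fieldType) (N : nat) (tau : V -> 'I_N).
Hypothesis tau_inj : injective tau.
Local Notation T := {mpoly K[N]}.
Implicit Types (v w : V) (A S Z : {set V}) (p : T) (m : 'X_{1..N}).

Lemma mcoeffXUM (i : 'I_N) p m :
  ('X_i * p)@_m = if (0 < m i)%N then p@_(m - U_(i)) else 0.
Proof.
rewrite mulrC; case: ifP => mi.
  have Um : (U_(i) <= m)%MM by rewrite lep1mP -lt0n.
  by rewrite -{1}[m](submK Um) addmC mcoeffMX.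
apply: memN_msupp_eq0; rewrite (perm_mem (msuppMX _ _)).
apply/mapP=> -[m' _ mE]; move: mi.
by rewrite mE mnmDE mnm1E eqxx.
Qed.

Lemma mcoeff_signM n p m : ((-1) ^+ n * p)@_m = (-1) ^+ n * p@_m.
Proof.
by rewrite -signr_odd -[in RHS]signr_odd; case: odd;
  rewrite ?expr1 ?mulN1r ?mcoeffN // !mul1r.
Qed.

Definition free_of Z m := [forall u in Z, m (tau u) == 0%N].

(** The K-linear part of the homotopy: keep the monomials divisible by the variable
of v and by no variable of Z, and divide them by the variable of v. *)
Definition divX v Z p : T :=
  \sum_(m <- msupp p | (0 < m (tau v))%N && free_of Z m)
     p@_m *: 'X_[m - U_(tau v)].

Lemma mcoeff_divX v Z p m : v \notin Z ->
  (divX v Z p)@_m = if free_of Z m then p@_(m + U_(tau v)) else 0.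
Proof.
move=> vZ; have freeD : free_of Z (m + U_(tau v)) = free_of Z m.
  apply: eq_forallb_in => u uZ; rewrite mnmDE mnm1E (inj_eq tau_inj).
  by case: (eqVneq v u) uZ => [<-|_ _]; rewrite ?(negPf vZ) //= addn0.
rewrite /divX raddf_sum /= big_mkcond /=.
pose k := (m + U_(tau v))%MM.
transitivity (\sum_(m' <- msupp p | m' == k) if free_of Z m then p@_k else 0).
  rewrite [RHS]big_mkcond; apply: eq_bigr => m' _.
  case: (eqVneq m' k) => [->|m'k].
    rewrite mnmDE mnm1E eqxx addn1 /= freeD; case: ifP => //= _.
    by rewrite mcoeffZ mcoeffX addmK eqxx mulr1.
  case: ifP => // /andP[m'v _]; rewrite mcoeffZ mcoeffX.
  case: eqP => [mE|]; last by rewrite mulr0.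
  by case/eqP: m'k; rewrite /k -mE submK // lep1mP -lt0n.
rewrite big_const_seq iter_addr_0 count_uniq_mem // mcoeff_msupp.
by case: eqP => [kE|] //=; rewrite -/k kE if_same.
Qed.

(** In a fixed multidegree the Koszul complex is the simplicial chain complex of
the full simplex on the vertices of S that lie in A or whose variable divides the
monomial.  This is the cone homotopy with apex the least such vertex w; the second
argument of [divX] says that no smaller vertex occurs, and the sign is +1 as w comes
first. *)
Definition cone_htpy S (c : {set V} -> T) A : T :=
  if (A \subset S) then
    if [pick w in A | [forall u in A, (rk w <= rk u)%N]] is Some w
    then divX w [set u in S | (rk u < rk w)%N] (c (A :\ w))
    else 0
  else 0.

Lemma mcoeff_cone_htpy S c A w m : A \subset S -> w \in A ->
    {in A, forall u, rk w <= rk u}%N ->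
  (cone_htpy S c A)@_m =
    if free_of [set u in S | (rk u < rk w)%N] m
    then (c (A :\ w))@_(m + U_(tau w)) else 0.
Proof.
move=> AS wA minw; rewrite /cone_htpy AS; case: pickP => [w' | /(_ w)].
  case/andP=> w'A /forall_inP minw'.
  have -> : w' = w by apply/eqP; rewrite -rk_eq eqn_leq minw // minw'.
  by rewrite mcoeff_divX // inE ltnn andbF.
by rewrite wA => /forall_inP[].
Qed.

Lemma ex_rk_min (P : pred V) v : P v ->
  exists2 w, P w & forall u, P u -> (rk w <= rk u)%N.
Proof. by move=> Pv; case: (arg_minnP (@rk V) Pv) => w; exists w. Qed.

(** The last hypothesis says that [c set0] is in the ideal of the variables of S: it
excludes the multidegrees whose simplex is empty, where there is no apex.  Given the
apex W of the multidegree of (m, A): if W is not in A, only the summand v = W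
survives; if W is in A, the cycle condition at A minus W expresses the coefficient
of [c A] through the other summands. *)
Lemma koszul_exact S (c : {set V} -> T) :
    (forall A, ~~ (A \subset S) -> c A = 0) ->
    (forall A, \sum_(v in S :\: A)
       (-1) ^+ before v A * ('X_(tau v) * c (v |: A)) = 0) ->
    (forall m, free_of S m -> (c set0)@_m = 0) ->
  forall A, \sum_(v in S :\: A)
    (-1) ^+ before v A * ('X_(tau v) * cone_htpy S c (v |: A)) = c A.
Proof.
move=> cS cyc aug A.
have [AS|AS] := boolP (A \subset S); last first.
  rewrite cS // big1 // => v _; rewrite /cone_htpy subUset (negPf AS) andbF.
  by rewrite !mulr0.
apply/mpolyP=> m; rewrite raddf_sum /=.
under eq_bigr => v _ do rewrite mcoeff_signM mcoeffXUM.
(* W becomes the apex for the multidegree of the monomial m in position A *)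
have [W|noW] := pickP [pred u in S | (u \in A) || (0 < m (tau u))%N]; last first.
  have freem u : u \in S -> (u \notin A) && (m (tau u) == 0%N).
    by move=> uS; have := noW u; rewrite /= uS /= eqn0Ngt -negb_or => ->.
  have A0 : A = set0.
    apply/setP=> u; rewrite inE; apply/negP => uA.
    by have := freem u (subsetP AS u uA); rewrite uA.
  rewrite A0 aug; last by apply/forall_inP=> u /freem /andP[].
  rewrite big1 // => v; rewrite inE => /andP[_ /freem /andP[_ /eqP->]].
  by rewrite mulr0.
case/ex_rk_min=> {}W /= /andP[WS WAm] minW.
have freeW m' : (forall u, u \in S -> (rk u < rk W)%N -> m' (tau u) <= m (tau u))%N ->
    free_of [set u in S | (rk u < rk W)%N] m'.
  move=> m'm; apply/forall_inP=> u; rewrite inE => /andP[uS uW].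
  rewrite -leqn0 (leq_trans (m'm u uS uW)) // leqNgt; apply: contraTN uW => mu.
  by rewrite -leqNgt minW // uS mu orbT.
have minA : {in A, forall u, rk W <= rk u}%N.
  by move=> u uA; rewrite minW // uA (subsetP AS).
have [WA|WA] := boolP (W \in A).
  have WA' : W \notin A :\ W by rewrite !inE eqxx.
  have AE : A = W |: A :\ W by rewrite setD1K.
  have /(congr1 (mcoeff (m + U_(tau W)))) := cyc (A :\ W).
  rewrite raddf_sum /= (bigD1 W) /=; last by rewrite inE WA'.
  rewrite mcoeff_signM mcoeffXUM mnmDE mnm1E eqxx addn1 /= addmK setD1K //.
  rewrite before_eq0 ?expr0 ?mul1r; last by move=> u; rewrite !inE => /andP[_ /minA].
  rewrite mcoeff0 => /eqP; rewrite addr_eq0 => /eqP ->; rewrite -sumrN.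
  apply: eq_big => [v|v].
    by rewrite !inE; case: (eqVneq v W) => [->|_]; rewrite ?WA ?andbF ?andbT.
  rewrite inE => /andP[vA vS].
  have vW : v != W by apply: contraNneq vA => ->.
  rewrite mcoeff_signM mcoeffXUM mnmDE mnm1E (inj_eq tau_inj) [W == v]eq_sym.
  rewrite (negPf vW) addn0; case: ifP => mv; last by rewrite !mulr0 oppr0.
  have Wv : (rk W < rk v)%N.
    by rewrite ltn_neqAle rk_eq eq_sym vW minW // vS mv orbT.
  rewrite (@mcoeff_cone_htpy _ _ _ W) ?subUset ?sub1set ?vS //; last 2 first.
  - by rewrite !inE WA orbT.
  - by move=> u; rewrite !inE => /orP[/eqP->|/minA//]; apply: ltnW.
  rewrite freeW; last by move=> u _ _; rewrite mnmBE leq_subr.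
  rewrite {1}AE beforeU1 // Wv exprS mulN1r mulNr; congr (- (_ * mcoeff _ _)).
    apply/mnmP=> j; rewrite !(mnmDE, mnmBE, mnm1E).
    case: (eqVneq (tau v) j) => [<-|_]; last by rewrite !subn0.
    by rewrite (inj_eq tau_inj) eq_sym (negPf vW) !addn0.
  by congr c; apply/setP=> u; rewrite !inE; case: (eqVneq u v) => // ->; rewrite vW.
have mW : (0 < m (tau W))%N by move: WAm; rewrite (negPf WA).
rewrite (bigD1 W) /=; last by rewrite inE WA.
rewrite mW before_eq0 // expr0 mul1r (@mcoeff_cone_htpy _ _ _ W); first last.
- by move=> u; rewrite !inE => /orP[/eqP->|/minA].
- by rewrite !inE eqxx.
- by rewrite subUset sub1set WS.
rewrite freeW; last by move=> u _ _; rewrite mnmBE leq_subr.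
rewrite setU1K // submK ?lep1mP -?lt0n // big1 ?addr0 // => v.
rewrite !inE => /andP[/andP[vA vS] vW].
case: ifP => mv; last by rewrite mulr0.
have [w] := @ex_rk_min (mem (v |: A)) v (setU11 v A).
move=> /= wvA minw; rewrite (@mcoeff_cone_htpy _ _ _ w) //; last first.
  by rewrite subUset sub1set vS.
case: ifP => [/forall_inP/(_ W)|]; last by rewrite mulr0.
rewrite inE WS mnmBE mnm1E (inj_eq tau_inj) (negPf vW) subn0 -[_ == 0%N]negbK.
rewrite -lt0n mW => freew; exfalso; suff /freew : (rk W < rk w)%N by [].
rewrite ltn_neqAle rk_eq; apply/andP; split.
  by apply: contraTneq wvA => <-; rewrite !inE negb_or eq_sym vW.
by move: wvA; rewrite !inE => /orP[/eqP->|/minA//]; rewrite minW // vS mv orbT.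
Qed.
End KoszulExactness.

(** * The cubical resolution of the ideal of a simplicial complex *)

Section FaceIdeal.
Variables (V : finType) (K : fieldType) (D : pred {set V}).
Hypothesis subD : forall A B : {set V}, B \subset A -> D A -> D B.
Local Notation T := {mpoly K[#|{: V + V}|]}.
Local Notation mnm := 'X_{1..#|{: V + V}|}.
Local Notation chain := ({set V} -> {set V} -> T).
Implicit Types (v w : V) (A S : {set V}) (c : chain) (m : mnm).

Definition tau v : 'I_#|{: V + V}| := enum_rank (inr v : V + V).

Lemma tau_inj : injective tau.
Proof. by move=> v w /enum_rank_inj[]. Qed.

Definition mon S : mnm :=
  (\sum_(v in S) U_(enum_rank (inl v : V + V)) + \sum_(v in ~: S) U_(tau v))%MM.

Lemma indep_monX S : indep_mon K S = 'X_[mon S].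
Proof. by rewrite mpolyXD !(big_morph _ (@mpolyXD _ _) (@mpolyX0 _ _)). Qed.

Lemma mon_tau S v : mon S (tau v) = (v \notin S).
Proof.
rewrite mnmDE !mnm_sumE big1 ?add0n => [|w _]; last first.
  by rewrite mnm1E (inj_eq enum_rank_inj).
under eq_bigr => w _ do rewrite mnm1E (inj_eq tau_inj).
have [vS|vS] := boolP (v \in S).
  rewrite big1 // => w; rewrite inE; apply: contraNeq.
  by rewrite eqb0 negbK => /eqP ->.
rewrite (bigD1 v) ?inE //= eqxx big1 // => w /andP[_ /negPf ->] //.
Qed.

(** On cells, the two ends of the interval in direction v, each with the variable
that corrects the multidegree: t_v where v stays in S, - s_v where v is removed.
It acts on coefficient functions, so S is the target and [v |: S] the source. *)
Definition edge v (f : {set V} -> T) S : T :=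
  if v \in S then tvar K v * f S else - (svar K v * f (v |: S)).

(** Chains of all degrees are treated at once, as coefficient functions on pairs
(S, A); [supported] singles out the combinations of cells of one degree. *)
Definition bdry c S A : T :=
  \sum_(v | v \notin A)
    (-1) ^+ before v A * edge v (fun S' => c S' (v |: A)) S.

Definition cell i S A := [&& D S, A \subset S & #|A| == i].

Definition supported i c := forall S A, ~~ cell i S A -> c S A = 0.

Definition aug c : T := \sum_S c S set0 * indep_mon K S.

Lemma edge_sum (I : finType) (P : pred I) (a : I -> T) F v S :
  edge v (fun S' => \sum_(j | P j) a j * F j S') S
    = \sum_(j | P j) a j * edge v (F j) S.
Proof.
rewrite /edge; case: ifP => _; rewrite mulr_sumr -?sumrN;
  by apply: eq_bigr => j _; rewrite ?mulrN mulrCA.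
Qed.

Lemma bdry_sum (I : finType) (a : I -> T) (F : I -> chain) S A :
  bdry (fun S A => \sum_j a j * F j S A) S A = \sum_j a j * bdry (F j) S A.
Proof.
rewrite /bdry; under eq_bigr => v _ do rewrite edge_sum mulr_sumr.
rewrite exchange_big; apply: eq_bigr => j _; rewrite mulr_sumr.
by apply: eq_bigr => v _; rewrite mulrCA.
Qed.

Lemma eq_bdry c c' S A : c =2 c' -> bdry c S A = bdry c' S A.
Proof.
by move=> cc'; apply: eq_bigr => v _; rewrite /edge !cc'.
Qed.

Lemma bdryD c c' S A :
  bdry (fun S A => c S A + c' S A) S A = bdry c S A + bdry c' S A.
Proof.
rewrite /bdry -big_split /=; apply: eq_bigr => v _; rewrite -mulrDr /edge.
by congr (_ * _); case: ifP => _; rewrite mulrDr ?opprD.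
Qed.

Lemma bdryN c S A : bdry (fun S A => - c S A) S A = - bdry c S A.
Proof.
rewrite /bdry -sumrN; apply: eq_bigr => v _; rewrite -mulrN /edge.
by congr (_ * _); case: ifP => _; rewrite mulrN.
Qed.

Lemma bdry_supported i c : supported i.+1 c -> supported i (bdry c).
Proof.
move=> c0 S A /negP SA; apply: big1 => v vA; rewrite /edge.
have cardA : #|A| == i = (#|v |: A| == i.+1) by rewrite cardsU1 vA.
case: ifP => vS; rewrite c0 ?(mulr0, oppr0) //; apply/negP => /and3P[DS AS Ai];
  apply: SA; rewrite /cell cardA Ai andbT.
  by rewrite DS; apply: subset_trans AS; apply: subsetUr.
rewrite (subD _ DS) ?subsetUr //=; apply/subsetP=> u uA.
have /setU1P[uv|//] : u \in v |: S by rewrite (subsetP AS) // inE uA orbT.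
by rewrite -uv uA in vA.
Qed.

(** Different directions act on different coordinates of the cube. *)
Lemma edgeC v w f S : v != w -> edge v (edge w f) S = edge w (edge v f) S.
Proof.
move=> vw; rewrite /edge !inE [w == v]eq_sym (negPf vw) /=.
by case: ifP => _; case: ifP => _; rewrite ?mulrN ?opprK mulrCA // setUCA.
Qed.

Lemma bdry_bdry c S A : bdry (bdry c) S A = 0.
Proof.
rewrite /bdry; pose G v w := (-1) ^+ before v A * (-1) ^+ before w (v |: A) *
  edge v (edge w (fun S' => c S' (w |: (v |: A)))) S.
rewrite -[RHS](@sum_swap_eq0 _ _ [pred v | v \notin A] G).
  apply: eq_bigr => v vA; rewrite edge_sum mulr_sumr.
  by apply: eq_big => [w|w _]; rewrite ?mulrA // !inE negb_or andbC.
move=> v w vw vA wA; rewrite /G (sign_swap _ vw vA wA) mulNr (edgeC _ _ vw).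
by rewrite setUCA.
Qed.

(** For v in S, t_v u_S = s_v u_(S minus v): the two ends of each edge cancel. *)
Lemma aug_bdry c : aug (bdry c) = 0.
Proof.
rewrite /aug /bdry.
under eq_bigr => S _ do rewrite mulr_suml.
rewrite exchange_big big1 // => v _ /=.
rewrite setU0 before_eq0 ?expr0; last by move=> u; rewrite inE.
rewrite (bigID (fun S : {set V} => v \in S)) /=.
rewrite [X in _ + X](reindex_onto (fun S => S :\ v) (fun S => v |: S)) /=; last first.
  by move=> S vS; rewrite setU1K.
apply/eqP; rewrite addr_eq0 -sumrN; apply/eqP; apply: eq_big => [S|S vS].
  rewrite !inE eqxx /=; apply/idP/eqP => [vS|<-]; last exact: setU11.
  by rewrite setD1K.
rewrite !mul1r /edge vS !inE eqxx /= setD1K // mulNr opprK.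
rewrite ![_ * c _ _]mulrC -!mulrA; congr (_ * _).
rewrite /indep_mon (big_setD1 v vS) /= -!mulrA mulrCA; congr (_ * _).
rewrite mulrCA; congr (_ * _).
rewrite [RHS](big_setD1 v) ?inE ?eqxx //=; congr (_ * _).
by apply: eq_bigl => u; rewrite !inE; case: eqP => // ->; rewrite vS.
Qed.

(** In the top layer the terms removing v would come from larger sets. *)
Lemma bdry_top k c S A : (forall S A, (k < #|S|)%N -> c S A = 0) ->
    (k <= #|S|)%N ->
  bdry c S A =
    \sum_(v in S :\: A) (-1) ^+ before v A * ('X_(tau v) * c S (v |: A)).
Proof.
move=> ck kS; rewrite /bdry (bigID (fun v => v \in S)) /= addrC big1 ?add0r.
  by apply: eq_big => [v|v /andP[_ vS]]; rewrite ?inE // /edge vS.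
move=> v /andP[_ vS]; rewrite /edge (negPf vS) ck ?mulr0 ?oppr0 ?mulr0 //.
by rewrite cardsU1 vS.
Qed.

(** Suppose that m avoids the variables t_v, v in S.  Then no t_v
with v in S divides m u_S, whereas t_v divides u_S' for every v outside S'.  So u_S'
can only contribute to this monomial if S \subset S', which the maximality of #|S|
allows for S' = S alone. *)
Lemma aug_top k c S m : (forall S A, (k < #|S|)%N -> c S A = 0) ->
  (k <= #|S|)%N -> aug c = 0 -> free_of tau S m -> (c S set0)@_m = 0.
Proof.
move=> ck kS /(congr1 (mcoeff (m + mon S))) + mS.
rewrite /aug raddf_sum mcoeff0 (bigD1 S) //= indep_monX [(m + _)%MM]addmC mcoeffMX.
rewrite big1 ?addr0 // => S' S'S; rewrite indep_monX.
apply: memN_msupp_eq0; rewrite (perm_mem (msuppMX _ _)).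
apply/mapP=> -[m' m'c mE].
have SS' : S \subset S'.
  apply/subsetP=> v vS; apply: contraTT isT => vS'.
  have := congr1 (fun m : mnm => m (tau v)) mE.
  rewrite /= (mnmDE _ (mon S)) (mnmDE _ (mon S')) !mon_tau vS vS'.
  by rewrite (eqP (forall_inP mS v vS)).
case/eqP: S'S; apply/esym/eqP; rewrite eqEcard SS' (leq_trans _ kS) //.
rewrite leqNgt; apply: contraTN m'c => /ck ->.
by rewrite msupp0.
Qed.

Lemma cone_htpy_neq0 S (f : {set V} -> T) A : cone_htpy tau S f A != 0 ->
  A \subset S /\ exists2 w, w \in A & f (A :\ w) != 0.
Proof.
rewrite /cone_htpy; case: ifP => [AS|_]; last by rewrite eqxx.
case: pickP => [w /andP[wA _]|_]; last by rewrite eqxx.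
move=> fA; split=> //; exists w => //; apply: contraNneq fA => ->.
by rewrite /divX msupp0 big_nil.
Qed.

(** Downward induction along the layers: the homotopy [cone_htpy], applied for each S
separately, produces a chain whose boundary agrees with c on the top layer. *)
Lemma bdry_exact i c : supported i c -> (forall S A, bdry c S A = 0) ->
    (i = 0%N -> aug c = 0) ->
  exists2 w, supported i.+1 w & forall S A, bdry w S A = c S A.
Proof.
have [k] : exists k, forall S A, (k <= #|S|)%N -> c S A = 0.
  exists #|V|.+1 => S A; rewrite ltnNge; case/negP.
  by rewrite -cardsT subset_leq_card.
elim: k c => [|k IHk] c ck ci dc ac.
  exists (fun _ _ => 0) => [//|S A]; rewrite ck //.
  by apply: big1 => v _; rewrite /edge; case: ifP; rewrite !mulr0 ?oppr0 ?mulr0.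
pose w0 : chain := fun S => cone_htpy tau S (c S).
have w0k S A : (k < #|S|)%N -> w0 S A = 0.
  move=> kS; apply/eqP; apply: contraT => /cone_htpy_neq0[_ [w _]].
  by rewrite ck ?eqxx.
have w0i : supported i.+1 w0.
  move=> S A; apply: contraNeq => /cone_htpy_neq0[AS [w wA]].
  apply: contraNT => SA; apply/eqP/ci; apply: contraNN SA => /and3P[DS _ Ai].
  by rewrite /cell DS AS -(setD1K wA) cardsU1 !inE eqxx /= add1n eqSS.
have dw0 S A : (k <= #|S|)%N -> bdry w0 S A = c S A.
  move=> kS; rewrite (bdry_top _ w0k) //; apply: (koszul_exact tau_inj).
  - by move=> B BS; apply: ci; rewrite /cell (negPf BS) andbF.
  - by move=> B; rewrite -(bdry_top _ ck).
  - move=> m mS; have [i0|i0] := eqVneq i 0%N.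
      exact: (aug_top ck kS (ac i0) mS).
    by rewrite ci ?mcoeff0 // /cell cards0 eq_sym (negPf i0) !andbF.
have [||||w wi dw] := IHk (fun S A => c S A - bdry w0 S A).
- by move=> S A kS; rewrite dw0 // subrr.
- by move=> S A SA; rewrite ci // (bdry_supported w0i SA) subrr.
- by move=> S A; rewrite bdryD bdryN dc bdry_bdry subrr.
- move=> i0; rewrite /aug; under eq_bigr => S _ do rewrite mulrBl.
  by rewrite sumrB [X in X - _]ac // [X in _ - X]aug_bdry subrr.
exists (fun S A => w S A + w0 S A) => [S A SA|S A].
  by rewrite wi // w0i // addr0.
by rewrite bdryD dw subrK.
Qed.

(** ** The complex as a sequence of matrices *)

Definition cells i : {set {set V} * {set V}} := [set x | cell i x.1 x.2].

Definition chain_of i (v : 'rV[T]_#|cells i|) : chain :=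
  fun S A => \sum_j v 0 j * (enum_val j == (S, A))%:R.

Definition row_of i c : 'rV[T]_#|cells i| :=
  \row_j c (enum_val j).1 (enum_val j).2.

Lemma enum_val_cell i (j : 'I_#|cells i|) : cell i (enum_val j).1 (enum_val j).2.
Proof. by have := enum_valP j; rewrite inE. Qed.

Lemma chain_ofE i (v : 'rV[T]_#|cells i|) j :
  chain_of v (enum_val j).1 (enum_val j).2 = v 0 j.
Proof.
rewrite /chain_of (bigD1 j) //= -surjective_pairing eqxx mulr1 big1 ?addr0 //.
by move=> k /negPf kj; rewrite (inj_eq enum_val_inj) kj mulr0.
Qed.

Lemma chain_ofK i : cancel (@chain_of i) (row_of i).
Proof. by move=> v; apply/rowP=> j; rewrite mxE chain_ofE. Qed.

Lemma chain_of_supported i (v : 'rV[T]_#|cells i|) : supported i (chain_of v).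
Proof.
move=> S A SA; apply: big1 => j _; case: eqP => [jE|_]; last exact: mulr0.
by case/negP: SA; have := enum_val_cell j; rewrite jE.
Qed.

Lemma supported_eq i c c' : supported i c -> supported i c' ->
  row_of i c = row_of i c' -> c =2 c'.
Proof.
move=> ci c'i /rowP cc' S A.
have [SA|SA] := boolP (cell i S A); last by rewrite ci // c'i.
have SAi : (S, A) \in cells i by rewrite inE.
by have := cc' (enum_rank_in SAi (S, A)); rewrite !mxE enum_rankK_in.
Qed.

Lemma row_ofK i c : supported i c -> chain_of (row_of i c) =2 c.
Proof.
move=> ci; apply: (@supported_eq i) => //; first exact: chain_of_supported.
exact: chain_ofK.
Qed.

Definition cubical_diff i : 'M[T]_(#|cells i.+1|, #|cells i|) :=
  \matrix_(j, k) bdry (fun S A => (enum_val j == (S, A))%:R)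
    (enum_val k).1 (enum_val k).2.

Definition cubical_aug : 'cV[T]_#|cells 0| :=
  \col_j indep_mon K (enum_val j).1.

Lemma mul_cubical_diff i (v : 'rV[T]_#|cells i.+1|) :
  v *m cubical_diff i = row_of i (bdry (chain_of v)).
Proof.
apply/rowP=> k; rewrite !mxE bdry_sum.
by apply: eq_bigr => j _; rewrite !mxE.
Qed.

Lemma mul_cubical_aug (v : 'rV[T]_#|cells 0|) : (v *m cubical_aug) 0 0 = aug (chain_of v).
Proof.
rewrite !mxE /aug; under [RHS]eq_bigr => S _ do rewrite mulr_suml.
rewrite exchange_big; apply: eq_bigr => j _; rewrite mxE.
have /and3P[_ _ A0] := enum_val_cell j.
have jE S : (enum_val j == (S, set0)) = (S == (enum_val j).1).
  by rewrite [enum_val j]surjective_pairing xpair_eqE (cards0_eq (eqP A0)) eqxx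
    andbT eq_sym.
rewrite (bigD1 (enum_val j).1) //= jE eqxx mulr1 big1 ?addr0 //.
by move=> S /negPf Sj; rewrite jE Sj mulr0 mul0r.
Qed.

Definition cubical_resolution : free_sequence K #|{: V + V}| :=
  FreeSequence (fun i _ => Posz (#|V| + i)) cubical_diff cubical_aug.

Definition face_gens : seq T := [seq indep_mon K A | A <- enum D].

Lemma indep_mon_homog S : indep_mon K S \is #|V|.-homog.
Proof.
rewrite indep_monX dhomogX /= mdegD !mdeg_sum.
under eq_bigr => v _ do rewrite mdeg1.
under [X in (_ + X)%N]eq_bigr => v _ do rewrite mdeg1.
by rewrite !sum1_card cardsC.
Qed.

Lemma edge_unit_homog v (f : {set V} -> bool) S :
  edge v (fun S' => (f S')%:R) S \is 1.-homog.
Proof.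
have homX j (b : bool) : ('X_j * b%:R : T) \is 1.-homog.
  case: b; first by rewrite mulr1 dhomogX /= mdeg1.
  by rewrite mulr0 dhomog0.
by rewrite /edge; case: ifP => _; rewrite ?dhomogN homX.
Qed.

Lemma edge_irrelevant v f S : edge v f S \in @irrelevant_ideal K #|{: V + V}|.
Proof.
have X_irr j p : 'X_j * p \in @irrelevant_ideal K #|{: V + V}|.
  rewrite mulrC; apply: ideal_genMl; apply: mem_ideal_gen.
  by apply: map_f; rewrite mem_enum.
by rewrite /edge; case: ifP => _; rewrite ?rpredN X_irr.
Qed.

Lemma cubical_exact i (v : 'rV[T]_#|cells i|) :
    supported i (chain_of v) -> (forall S A, bdry (chain_of v) S A = 0) ->
    (i = 0%N -> aug (chain_of v) = 0) ->
  exists u, u *m cubical_diff i = v.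
Proof.
move=> vi dv av; have [c ci dc] := bdry_exact vi dv av.
exists (row_of i.+1 c); rewrite mul_cubical_diff -[RHS]chain_ofK.
by apply/rowP=> j; rewrite !mxE -dc; apply/eq_bdry/row_ofK.
Qed.

Lemma chain_mul_cubical_diff i (v : 'rV[T]_#|cells i.+1|) :
  chain_of (v *m cubical_diff i) =2 bdry (chain_of v).
Proof.
rewrite mul_cubical_diff; apply: row_ofK; apply: bdry_supported.
exact: chain_of_supported.
Qed.

Lemma cubical_resolution_minimal :
  is_minimal_graded_free_resolution face_gens cubical_resolution.
Proof.
split=> [j|i j k|p|v|i v|i j k].
- by rewrite /= addn0 mxE indep_mon_homog.
- rewrite [fres_shift _]/= [fres_shift _]/= addnS -addn1 PoszD addrAC subrr add0r /= mxE.
  apply: rpred_sum => v _; rewrite rpredMsign.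
  exact: edge_unit_homog.
- split=> [|[v <-]]; last first.
    rewrite mxE; apply: rpred_sum => j _; apply: ideal_genMl.
    apply: mem_ideal_gen; rewrite mxE map_f // mem_enum.
    by have /and3P[] := enum_val_cell j.
  case/ideal_genP=> c ->.
  have gen_im (s : 'I_(size face_gens)) :
      exists u : 'rV_#|cells 0|, (u *m cubical_aug) 0 0 = face_gens`_s.
    have /mapP[S] : face_gens`_s \in face_gens by rewrite mem_nth.
    rewrite mem_enum => DS ->.
    have S0 : (S, set0) \in cells 0 by rewrite inE /cell /= sub0set cards0 eqxx !andbT.
    exists (delta_mx 0 (enum_rank_in S0 (S, set0))).
    by rewrite -rowE !mxE enum_rankK_in.
  have [f fE] := boolp.choice gen_im.
  exists (\sum_s c s *: f s); rewrite mulmx_suml summxE.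
  by apply: eq_bigr => s _; rewrite -scalemxAl mxE fE.
- split=> [v0|[w <-]].
    apply: cubical_exact; first exact: chain_of_supported.
      move=> S A; apply: big1 => u uA; rewrite /edge.
      have z S' : chain_of v S' (u |: A) = 0.
        by apply: chain_of_supported; rewrite /cell cardsU1 uA /= !andbF.
      by rewrite !z !mulr0 oppr0 if_same mulr0.
    by move=> _; rewrite -mul_cubical_aug v0 mxE.
  apply/matrixP=> s t; rewrite !ord1 [RHS]mxE mul_cubical_aug.
  rewrite -[RHS](aug_bdry (chain_of w)).
  by apply: eq_bigr => S _; rewrite chain_mul_cubical_diff.
- split=> [v0|[w <-]].
    apply: cubical_exact => //; first exact: chain_of_supported.
    move=> S A; rewrite -chain_mul_cubical_diff v0.
    by apply: big1 => j _; rewrite mxE mul0r.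
  apply/rowP=> k; rewrite mul_cubical_diff !mxE.
  apply: etrans (bdry_bdry (chain_of w) _ _).
  exact/eq_bdry/chain_mul_cubical_diff.
- by rewrite mxE; apply: rpred_sum => v _; rewrite rpredMsign edge_irrelevant.
Qed.

Lemma card_cells i : #|cells i| = (\sum_(S | D S) 'C(#|S|, i))%N.
Proof.
rewrite -sum1_card (eq_bigl (fun x : {set V} * {set V} =>
  D x.1 && ((x.2 \subset x.1) && (#|x.2| == i)))); last by move=> x; rewrite inE.
rewrite -(pair_big_dep D (fun S A => (A \subset S) && (#|A| == i)) (fun _ _ => 1%N)) /=.
apply: eq_bigr => S _; rewrite sum1_card -cards_draws.
by apply: eq_card => A; rewrite !inE.
Qed.

Lemma face_gens_irrelevant : (0 < #|V|)%N ->
  {subset face_gens <= @irrelevant_ideal K #|{: V + V}|}.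
Proof.
case/card_gt0P=> v _ _ /mapP[S _ ->].
have X_irr j : 'X_j \in @irrelevant_ideal K #|{: V + V}|.
  by apply: mem_ideal_gen; apply: map_f; rewrite mem_enum.
rewrite /indep_mon; have [vS|vS] := boolP (v \in S).
  by rewrite (big_setD1 v vS) /= -mulrA mulrC; apply: ideal_genMl; apply: X_irr.
have vS' : v \in ~: S by rewrite inE.
by rewrite (big_setD1 v vS') /= mulrCA mulrC; apply: ideal_genMl; apply: X_irr.
Qed.

Theorem face_ideal_betti i : (0 < #|V|)%N ->
  betti_eq face_gens i (\sum_(S | D S) 'C(#|S|, i))%N.
Proof.
move=> V0; split=> [|F Fmin].
  by exists cubical_resolution; apply: cubical_resolution_minimal.
rewrite -card_cells.
exact: (minimal_rank_unique i (face_gens_irrelevant V0) Fmin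
  cubical_resolution_minimal).
Qed.

Theorem face_ideal_proj_dim d : (0 < #|V|)%N ->
    (exists2 S : {set V}, D S & #|S| = d) ->
    (forall S : {set V}, D S -> #|S| <= d)%N ->
  proj_dim_eq (quot_mod face_gens) d.+1.
Proof.
move=> V0 [S DS Sd] Dd.
apply: (proj_dim_minimal (face_gens_irrelevant V0) cubical_resolution_minimal).
  by rewrite /= card_cells (bigD1 S) //= Sd binn.
move=> i di; rewrite /= card_cells big1 // => A /Dd Ad.
by rewrite bin_small // (leq_ltn_trans Ad).
Qed.

End FaceIdeal.

(** * Counting the independent sets of the centipede *)

Section CentipedeCount.

Definition no_consecutive n (B : {set 'I_n}) : bool :=
  [forall x in B, forall y in B, x.+1 != y :> nat].

Definition positive_set n (B : {set 'I_n}) : bool :=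
  [forall x in B, 0 < x]%N.

Lemma no_consecutiveP n (B : {set 'I_n}) :
  reflect {in B &, forall x y : 'I_n, x.+1 != y :> nat} (no_consecutive B).
Proof.
apply: (iffP forall_inP) => [ncB x y xB yB|ncB x xB].
  exact: (forall_inP (ncB x xB)).
by apply/forall_inP=> y yB; apply: ncB.
Qed.

(** A set of indices below n.+1 is, up to a shift, a set of indices below n with or
without a new least element. *)
Local Notation up B := [set lift ord0 x | x in B].

Lemma mem_up n (B : {set 'I_n}) x : (lift ord0 x \in up B) = (x \in B).
Proof. exact/mem_imset/lift_inj. Qed.

Lemma ord0_up n (B : {set 'I_n}) : (ord0 \in up B) = false.
Proof. by apply/negP => /imsetP[x _]. Qed.

Lemma card_up n (B : {set 'I_n}) : #|up B| = #|B|.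
Proof. exact/card_imset/lift_inj. Qed.

Lemma no_consecutive_up n (B : {set 'I_n}) :
  no_consecutive (up B) = no_consecutive B.
Proof.
apply/no_consecutiveP/no_consecutiveP => ncB.
  move=> x y xB yB; have := ncB (lift ord0 x) (lift ord0 y).
  by rewrite !mem_up !lift0 eqSS; apply.
by move=> _ _ /imsetP[x xB ->] /imsetP[y yB ->]; rewrite !lift0 eqSS ncB.
Qed.

Lemma no_consecutive_up0 n (B : {set 'I_n}) :
  no_consecutive (ord0 |: up B) = no_consecutive B && positive_set B.
Proof.
apply/no_consecutiveP/andP=> [ncB|[/no_consecutiveP ncB /forall_inP B0]].
  split; last first.
    apply/forall_inP=> x xB; have := ncB ord0 (lift ord0 x).
    by rewrite !inE mem_up xB orbT eqxx lift0 eqSS eq_sym lt0n; apply.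
  apply/no_consecutiveP=> x y xB yB; have := ncB (lift ord0 x) (lift ord0 y).
  by rewrite !inE !mem_up xB yB !orbT !lift0 eqSS; apply.
move=> x y /setU1P[->|/imsetP[{}x xB ->]] /setU1P[->|/imsetP[{}y yB ->]] //.
  by rewrite lift0 eqSS eq_sym -lt0n B0.
by rewrite !lift0 eqSS ncB.
Qed.

Lemma positive_up n (B : {set 'I_n}) : positive_set (up B).
Proof. by apply/forall_inP=> _ /imsetP[x _ ->]. Qed.

Lemma positive_up0 n (B : {set 'I_n}) : positive_set (ord0 |: up B) = false.
Proof. by apply/negP => /forall_inP/(_ ord0); rewrite setU11 => /(_ isT). Qed.

Lemma sum_set_ordS n (P : pred {set 'I_n.+1}) (F : {set 'I_n.+1} -> nat) :
  (\sum_(B | P B) F B = \sum_(B : {set 'I_n} | P (up B)) F (up B)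
    + \sum_(B : {set 'I_n} | P (ord0 |: up B)) F (ord0 |: up B))%N.
Proof.
have down_up (B : {set 'I_n}) : lift ord0 @^-1: up B = B.
  by apply/setP=> x; rewrite inE mem_up.
have down_up0 (B : {set 'I_n}) : lift ord0 @^-1: (ord0 |: up B) = B.
  by apply/setP=> x; rewrite !inE mem_up.
have up_down (B : {set 'I_n.+1}) x :
    (x \in up (lift ord0 @^-1: B)) = (x != ord0) && (x \in B).
  case: (unliftP ord0 x) => [y|] ->; last by rewrite ord0_up.
  by rewrite mem_up inE.
rewrite (bigID (fun B : {set 'I_n.+1} => ord0 \in B)) [LHS]addnC /=; congr addn.
  rewrite (reindex_onto (fun B : {set 'I_n} => up B)
    (fun B => lift ord0 @^-1: B)) /=.
    by apply: eq_bigl => B; rewrite down_up eqxx ord0_up !andbT.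
  move=> B /andP[_ B0]; apply/setP=> x; rewrite up_down.
  by case: eqP => // ->; rewrite (negPf B0).
rewrite (reindex_onto (fun B : {set 'I_n} => ord0 |: up B)
  (fun B => lift ord0 @^-1: B)) /=.
  by apply: eq_bigl => B; rewrite down_up0 eqxx setU11 !andbT.
move=> B /andP[_ B0]; apply/setP=> x; rewrite inE up_down inE.
by case: eqP => // ->.
Qed.

(** The flag b asks in addition for 0 to be absent, as it must be when a new least
element is put below; this makes the recursion close on itself as Pascal's rule.  The
weight f allows the shift of cardinals by one, and m is any bound, as the terms with
j > n vanish. *)
Lemma sum_no_consecutive n (b : bool) m (f : nat -> nat) : (n < m)%N ->
  (\sum_(B : {set 'I_n} | no_consecutive B && (b ==> positive_set B)) f #|B|
   = \sum_(j < m) 'C(n + ~~ b - j, j) * f j)%N.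
Proof.
elim: n b m f => [|n IHn] b [|m] f // nm.
  rewrite (big_pred1 set0) => [|B]; last first.
    have -> : B = set0 by apply/setP=> -[].
    rewrite /= eqxx; apply/andP; split; first by apply/forall_inP=> -[].
    by apply/implyP=> _; apply/forall_inP=> -[].
  rewrite cards0 big_ord_recl big1 ?addn0 ?subn0 ?bin0 ?mul1n // => j _.
  by rewrite bin_small // lift0 ltnS; case: b.
rewrite sum_set_ordS.
under eq_bigl do rewrite no_consecutive_up positive_up implybT.
under eq_bigr do rewrite card_up.
under [X in (_ + X)%N]eq_bigl do
  rewrite no_consecutive_up0 positive_up0 implybF andbC.
under [X in (_ + X)%N]eq_bigr do rewrite cardsU1 ord0_up card_up add1n.
have := IHn false m.+1 f (ltnW nm); rewrite /= => ->.
case: b => /=.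
  rewrite [X in (_ + X)%N]big_pred0 // addn0.
  by apply: eq_bigr => j _; rewrite addn0 addn1.
have -> : (\sum_(B : {set 'I_n} | no_consecutive B && positive_set B)
  f #|B|.+1 = \sum_(j < m) 'C(n + false - j, j) * f j.+1)%N := IHn true m (f \o succn) nm.
rewrite [LHS]addnC big_ord_recl [RHS]big_ord_recl !bin0 addnCA; congr addn.
rewrite -big_split /=; apply: eq_bigr => j _.
rewrite /bump /= !add1n -mulnDl !addn0 !addn1 !subSS.
have [jn|nj] := leqP j n; first by rewrite subSn // binS addnC.
have -> : (n - j = 0)%N by apply/eqP; rewrite subn_eq0 ltnW.
have -> : (n.+1 - j = 0)%N by apply/eqP; rewrite subn_eq0.
by rewrite !bin0n; case: (nat_of_ord j) nj.
Qed.

Lemma sum_subsets (T : finType) (X : {set T}) m (f : nat -> nat) :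
  (#|X| < m)%N ->
  (\sum_(A : {set T} | A \subset X) f #|A| = \sum_(l < m) 'C(#|X|, l) * f l)%N.
Proof.
move=> Xm.
have cardm (A : {set T}) : A \subset X -> (#|A| < m)%N.
  by move=> AX; apply: leq_ltn_trans Xm; apply: subset_leq_card.
case: m Xm cardm => // m Xm cardm.
rewrite (partition_big (fun A : {set T} => inord #|A| : 'I_m.+1) xpredT) //=.
apply: eq_bigr => l _; rewrite -cards_draws -sum_nat_const /=.
apply: eq_big => [A|A /andP[AX /eqP <-]]; last by rewrite inordK // cardm.
rewrite inE; apply: andb_id2l => AX.
by rewrite -val_eqE /= inordK // cardm.
Qed.

(** The first set consists of leaves, the second one of spine vertices. *)
Definition join_sets n (p : {set 'I_n} * {set 'I_n}) : {set 'I_n + 'I_n} :=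
  [set x | match x with inl i => i \in p.1 | inr i => i \in p.2 end].

Lemma join_sets_bij n : bijective (@join_sets n).
Proof.
exists (fun S : {set 'I_n + 'I_n} =>
  ([set i | inl i \in S], [set i | inr i \in S])) => [[A B]|S].
  by congr (_, _); apply/setP=> x; rewrite !inE.
by apply/setP=> -[] x; rewrite !inE.
Qed.

Lemma card_join_sets n (A B : {set 'I_n}) : #|join_sets (A, B)| = (#|A| + #|B|)%N.
Proof.
rewrite -!sum1_card (eq_bigl (fun x : 'I_n + 'I_n =>
  match x with inl i => i \in A | inr i => i \in B end)).
  by rewrite big_sumType.
by move=> x; rewrite inE.
Qed.

Lemma independent_join_sets n (A B : {set 'I_n}) :
  independent (centipede n) (join_sets (A, B))
    = no_consecutive B && (A \subset ~: B).
Proof.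
apply/forall_inP/andP=> [indep|[/no_consecutiveP ncB /subsetP AB]].
  have {}indep x y : x \in join_sets (A, B) -> y \in join_sets (A, B) ->
      ~~ centipede n x y by move=> xS yS; apply: (forall_inP (indep x xS)).
  split.
    apply/no_consecutiveP=> i j iB jB; have := indep (inr i) (inr j).
    by rewrite !inE iB jB negb_or => /(_ isT isT)/andP[].
  apply/subsetP=> i iA; rewrite inE; apply/negP => iB.
  by have := indep (inl i) (inr i); rewrite !inE iA iB /= eqxx => /(_ isT isT).
move=> x xS; apply/forall_inP=> y; move: xS; rewrite !inE.
case: x y => i [] j //= iS jS.
- by apply: contraTneq (AB _ iS) => ->; rewrite inE jS.
- by apply: contraTneq (AB _ jS) => <-; rewrite inE iS.
- by rewrite negb_or !ncB.
Qed.

(** Sum first over the spine part B, of size j, then over the leaf part, of size l;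
the index k of the closed form is l + j. *)
Lemma sum_independent_centipede n (f : nat -> nat) :
  (\sum_(S | independent (centipede n) S) f #|S|
   = \sum_(k < n.+1) \sum_(j < k.+1)
       'C(n - j, n - k) * 'C(n.+1 - j, j) * f k)%N.
Proof.
rewrite (reindex (@join_sets n)) /=; last exact/onW_bij/join_sets_bij.
transitivity (\sum_(B : {set 'I_n} | no_consecutive B)
  \sum_(A : {set 'I_n} | A \subset ~: B) f (#|A| + #|B|))%N.
  rewrite (exchange_big_dep xpredT) //= pair_big_dep /=.
  by apply: eq_big => [[A B]|[A B] _]; rewrite ?independent_join_sets ?card_join_sets.
pose g j := (\sum_(l < n.+1) 'C(n - j, l) * f (l + j))%N.
transitivity (\sum_(B : {set 'I_n} | no_consecutive B) g #|B|)%N.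
  apply: eq_bigr => B _; rewrite (@sum_subsets _ _ n.+1 (fun l => f (l + #|B|)%N)).
    by rewrite /g cardsCs setCK card_ord.
  by rewrite ltnS -[X in (_ <= X)%N]card_ord max_card.
have -> : (\sum_(B : {set 'I_n} | no_consecutive B) g #|B|
    = \sum_(j < n.+1) 'C(n.+1 - j, j) * g j)%N.
  have := sum_no_consecutive false g (ltnSn n); rewrite /= addn1 => <-.
  by apply: eq_bigl => B; rewrite andbT.
under [RHS]eq_bigr => k _.
  rewrite (big_ord_widen n.+1 (fun j =>
    'C(n - j, n - k) * 'C(n.+1 - j, j) * f k)%N (ltn_ord k)).
  over.
rewrite (exchange_big_dep xpredT) //=; apply: eq_bigr => j _.
rewrite /g big_distrr /=.
pose h k := ('C(n - j, n - k) * 'C(n.+1 - j, j) * f k)%N.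
rewrite -[RHS](big_mkord (fun k => j < k.+1)%N h).
rewrite [RHS](big_cat_nat (n := j)) /=; [|by []|by rewrite ltnW].
rewrite [X in _ = (X + _)%N]big_nat_cond [X in _ = (X + _)%N]big_pred0 ?add0n; last first.
  by move=> k; apply/negP => /= /andP[kj]; rewrite leqNgt ltnS kj.
rewrite -[RHS]/(\sum_(0 + j <= k < n.+1 | (j < k.+1)%N) h k)%N big_addn.
rewrite -(big_mkord xpredT (fun l => 'C(n.+1 - j, j) * ('C(n - j, l) * f (l + j)))%N).
rewrite (big_cat_nat (n := n.+1 - j)) ?leq_subr //= [X in (_ + X)%N]big_nat_cond.
rewrite [X in (_ + X)%N]big1 ?addn0; last first.
  move=> l /andP[/andP[lj _] _]; rewrite (@bin_small (n - j)) ?muln0 //.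
  by rewrite -subSn ?leq_ord.
rewrite big_nat_cond [RHS]big_nat_cond; apply: eq_big => [l|l /andP[/andP[_ lj] _]].
  by rewrite ltnS leq_addl.
rewrite /h mulnA; congr (_ * _)%N.
have lnj : (l <= n - j)%N by rewrite -ltnS -subSn ?leq_ord.
by rewrite mulnC -(bin_sub lnj) [(l + j)%N]addnC subnDA.
Qed.

End CentipedeCount.

Theorem proposition3p2 (K : fieldType) (n : nat) (hn : (1 <= n)%N) :
  (forall i : nat,
     betti_eq (indep_gens (centipede n) K) i
       (\sum_(k < n.+1) \sum_(j < k.+1)
          'C(n - j, n - k) * 'C(n.+1 - j, j) * 'C(k, i))%N) /\
  proj_dim_eq (quot_mod (indep_gens (centipede n) K)) n.+1.
Proof.
have V0 : (0 < #|{: 'I_n + 'I_n}|)%N by rewrite card_sum card_ord addn_gt0 hn.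
pose D := [pred S : {set 'I_n + 'I_n} | independent (centipede n) S].
have subD (A B : {set 'I_n + 'I_n}) : B \subset A -> D A -> D B.
  move=> /subsetP BA /forall_inP DA; apply/forall_inP=> x /BA xA.
  by apply/forall_inP=> y /BA yA; apply: (forall_inP (DA x xA)).
split=> [i|].
  rewrite -(sum_independent_centipede n (fun k => 'C(k, i))).
  exact: (face_ideal_betti K subD i V0).
apply: (face_ideal_proj_dim K subD V0).
  exists (join_sets ([set: 'I_n], set0)).
    rewrite /D /= independent_join_sets setC0 subxx andbT.
    by apply/no_consecutiveP=> x y; rewrite inE.
  by rewrite card_join_sets cardsT card_ord cards0 addn0.
move=> S; have [u _ uK] := join_sets_bij n; rewrite -[S]uK; case: (u S) => A B.
rewrite /D /= independent_join_sets card_join_sets => /andP[_ /subset_leq_card].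
rewrite [#|~: B|]cardsCs setCK card_ord => AB.
by rewrite addnC -leq_subRL // -[X in (_ <= X)%N]card_ord max_card.
Qed.
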